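(* Let $d\ge 4$ and let $V\colon\mathbb{R}^d\to\mathbb{R}$ be Borel measurable. Then $$C_d^{-1}\,\|\Delta^{-1}|V|\|_\infty\le\|V\|_K\le 2^{(d-3)/2}\Big(C_d^{-1}\,\|\Delta^{-1}|V|\|_\infty+\kappa_d\,\|V\|_{d/2}\Big),$$ where $\kappa_d<\infty$ is the constant, depending only on $d$, $$\kappa_d=\left(\int_{\{w\in\mathbb{R}^d:\,|w|>1\}}\Big(e^{-\frac12(|w|-w\cdot e_1)}\,|w|^{-(d-1)/2}\Big)^{d/(d-2)}dw\right)^{(d-2)/d},\qquad e_1=(1,0,\ldots,0).$$
   Context: $C_d=\Gamma(d/2-1)/(4\pi^{d/2})$. For Borel measurable $V\colon\mathbb{R}^d\to\mathbb{R}$, $$-\Delta^{-1}|V|(x)=C_d\int_{\mathbb{R}^d}\frac{|V(z)|}{|z-x|^{d-2}}\,dz,\qquad \|\Delta^{-1}|V|\|_\infty=\sup_{x\in\mathbb{R}^d}C_d\int_{\mathbb{R}^d}\frac{|V(z)|}{|z-x|^{d-2}}\,dz,$$ $$\|V\|_{d/2}=\left(\int_{\mathbb{R}^d}|V(z)|^{d/2}\,dz\right)^{2/d}.$$ For $x,y\in\mathbb{R}^d$ (with $x\ne0$) let $$K(x,y)=\frac{e^{-(|x||y|-x\cdot y)/2}}{|x|^{d-2}}\,(1+|x||y|)^{d/2-3/2},$$ where $x\cdot y$ is the usual scalar product, and $$\|V\|_K=\sup_{x,y\in\mathbb{R}^d}\int_{\mathbb{R}^d}|V(z)|\,K(z-x,y)\,dz.$$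 All quantities take values in $[0,\infty]$. *)

(* Defs.v *)
From HB Require Import structures.
From mathcomp Require Import all_boot all_order all_algebra.
From mathcomp Require Import all_classical all_reals all_analysis.
From mathcomp Require Import measurable_realfun.

Set Implicit Arguments.
Unset Strict Implicit.
Unset Printing Implicit Defensive.

Import Order.TTheory GRing.Theory Num.Theory.
Import numFieldNormedType.Exports.

Local Open Scope classical_set_scope.
Local Open Scope ring_scope.

(* Borel sigma-algebra of R^n. The topology of 'rV[R]_n in the library comes
   from the max-norm, hence it is the usual one. *)
HB.instance Definition _ (R : realType) (n : nat) :=
  @isMeasurable.Build (sigma_display (@open 'rV[R]_n)) 'rV[R]_n
    <<s @open 'rV[R]_n >>
    (@sigma_algebra0 _ setT (@open 'rV[R]_n))
    (@sigma_algebraC _ (@open 'rV[R]_n))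
    (@sigma_algebra_bigcup _ setT (@open 'rV[R]_n)).

Section rV_cons.
Context {R : realType} {n : nat}.

Definition rV_cons (p : measurableTypeR R * 'rV[R]_n) : 'rV[R]_n.+1 :=
  \row_i if unlift ord0 i is Some j then p.2 ord0 j else p.1.

Lemma rV_cons0 p : rV_cons p ord0 ord0 = p.1.
Proof. by rewrite mxE unlift_none. Qed.

Lemma rV_cons_lift p j : rV_cons p ord0 (lift ord0 j) = p.2 ord0 j.
Proof. by rewrite mxE liftK. Qed.

Let open_ball_cover (U : set 'rV[R]_n.+1) : open U ->
  U = \bigcup_(k in [set k : 'rV[rat]_n.+1 * rat |
        0 < k.2 /\ ball (map_mx ratr k.1 : 'rV[R]_n.+1) (ratr k.2) `<=` U])
      ball (map_mx ratr k.1 : 'rV[R]_n.+1) (ratr k.2).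
Proof.
move=> oU; apply/seteqP; split=> [v Uv|v [k /= [k0 kU] kv]]; last exact: kU.
have /nbhs_ballP[e /= e0 eU] : nbhs v U by exact: open_nbhs_nbhs.
have /rat_in_itvoo[r /itvP r0e] : 0 < e / 2 by rewrite divr_gt0.
have rgt0 : 0 < (ratr r : R) by rewrite r0e.
have /choice[q vq] : forall i : 'I_n.+1, exists q : rat,
    `|(ratr q : R) - v ord0 i| < ratr r.
  move=> i.
  have /rat_in_itvoo[q /itvP qv] : v ord0 i < v ord0 i + ratr r
    by rewrite ltrDl.
  by exists q; rewrite gtr0_norm ?subr_gt0 ?qv// ltrBlDl qv.
exists (\row_i q i, r) => /=.
  split; first by rewrite -(ltr0q R).
  move=> w [_ qw]; apply: eU; split=> // i j.
  have := qw i j; rewrite !mxE /ball/= (ord1 i) => qwj.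
  have := vq j; rewrite distrC => vqj.
  rewrite (le_lt_trans (ler_distD (ratr (q j)) _ _))//.
  by rewrite (splitr e) ltrD// (lt_trans vqj _, lt_trans qwj _)// r0e.
by split=> // i j; rewrite !mxE /ball/= (ord1 i).
Qed.

Lemma measurable_rV_cons : measurable_fun setT rV_cons.
Proof.
apply: (@measurability _ _ _ _ _ _ (@open 'rV[R]_n.+1)) => // _ [U oU <-].
rewrite setTI (open_ball_cover oU) preimage_bigcup.
rewrite bigcup_mkcond; apply: countable_bigcupT_measurable => [|[q r]].
  exact: countableP.
case: ifPn => [/set_mem[/= r0 _]|//].
rewrite (_ : _ @^-1` _ =
    ball (ratr (q ord0 ord0) : R) (ratr r) `*`
    ball (map_mx ratr (\row_j q ord0 (lift ord0 j)) : 'rV[R]_n) (ratr r)).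
  apply: measurableX; first exact: measurable_ball.
  by apply: sub_sigma_algebra; apply: ball_open; rewrite ltr0q.
have r0R : 0 < (ratr r : R) by rewrite ltr0q.
apply/seteqP; split=> [p /= [_ h]|p /= [h1 [_ h2]]].
  split.
    by have := h ord0 ord0; rewrite rV_cons0 mxE.
  split=> // i j; have := h ord0 (lift ord0 j).
  by rewrite rV_cons_lift !mxE (ord1 i).
split=> // i j; rewrite (ord1 i) mxE.
case: (unliftP ord0 j) => [k|] ->; last by rewrite rV_cons0.
by rewrite rV_cons_lift; have := h2 ord0 k; rewrite !mxE.
Qed.

HB.instance Definition _ :=
  isMeasurableFun.Build _ _ _ _ rV_cons measurable_rV_cons.

Definition rV_uncons (v : 'rV[R]_n.+1) : measurableTypeR R * 'rV[R]_n :=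
  (v ord0 ord0, \row_j v ord0 (lift ord0 j)).

Lemma rV_consK : cancel rV_cons rV_uncons.
Proof.
move=> p; rewrite /rV_uncons rV_cons0 [RHS]surjective_pairing; congr (_, _).
by apply/rowP => j; rewrite mxE rV_cons_lift.
Qed.

Lemma measurable_rV_uncons : measurable_fun setT rV_uncons.
Proof.
apply: measurable_fun_pair.
  apply: (@measurability _ _ _ _ _ _ (@RGenOpens.G R)).
    exact: RGenOpens.measurableE.
  move=> _ [_ [x [y ->]] <-]; rewrite setTI; apply: sub_sigma_algebra.
  by apply: open_comp => [v _|]; [exact: coord_continuous|exact: interval_open].
apply: (@measurability _ _ _ _ _ _ (@open 'rV[R]_n)) => // _ [U oU <-].
rewrite setTI; apply: sub_sigma_algebra; apply: open_comp => // v _.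
move=> A /nbhs_ballP[e /= e0 eA]; apply/nbhs_ballP; exists e => //= w [_ vw].
by apply: eA; split=> // i j; rewrite !mxE.
Qed.

End rV_cons.

Section lebesgue_rV_succ.
Local Open Scope ereal_scope.
Context {R : realType} {n : nat}.
Variable m : {sigma_finite_measure set 'rV[R]_n -> \bar R}.

Definition lebesgue_rV_succ : set 'rV[R]_n.+1 -> \bar R :=
  pushforward (lebesgue_measure \x m) rV_cons.

Let succ0 : lebesgue_rV_succ set0 = 0.
Proof. exact: measure0. Qed.

Let succ_ge0 A : 0 <= lebesgue_rV_succ A.
Proof. exact: measure_ge0. Qed.

Let succ_sigma_additive : semi_sigma_additive lebesgue_rV_succ.
Proof. exact: measure_semi_sigma_additive. Qed.

HB.instance Definition _ := isMeasure.Build _ _ _ lebesgue_rV_succ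
  succ0 succ_ge0 succ_sigma_additive.

Let succ_sigma_finite : sigma_finite setT lebesgue_rV_succ.
Proof.
have /sigma_finiteP[F [TF ndF Foo]] := sigma_finiteT (@lebesgue_measure R).
have /sigma_finiteP[G [TG ndG Goo]] := sigma_finiteT m.
have mFG k : measurable (F k `*` G k).
  by apply: measurableX; [have [] := Foo k|have [] := Goo k].
exists (fun k => rV_uncons @^-1` (F k `*` G k)).
  rewrite -preimage_bigcup -[LHS](preimage_setT rV_uncons); congr (_ @^-1` _).
  rewrite -setXTT TF TG; apply/seteqP; split=> [[x y]|[x y] [k _ []/= Fx Gy]].
    move=> [/= [k _ Fkx] [l _ Gly]]; exists (maxn k l) => //; split.
    - by move: x Fkx; exact/subsetPset/ndF/leq_maxl.
    - by move: y Gly; exact/subsetPset/ndG/leq_maxr.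
  by split; exists k.
move=> k; split.
  by rewrite -[X in measurable X]setTI; exact: measurable_rV_uncons.
rewrite /lebesgue_rV_succ /pushforward -comp_preimage.
rewrite (_ : rV_uncons \o rV_cons = id); last first.
  by apply/funext => p /=; rewrite rV_consK.
have [mF Fk] := Foo k; have [mG Gk] := Goo k.
by rewrite product_measure1E// lte_mul_pinfty// ge0_fin_numE.
Qed.

HB.instance Definition _ := Measure_isSigmaFinite.Build _ _ _ lebesgue_rV_succ
  succ_sigma_finite.

End lebesgue_rV_succ.

Fixpoint lebesgue_rV (R : realType) (n : nat) :
    {sigma_finite_measure set 'rV[R]_n -> \bar R} :=
  match n with
  | 0 => \d_(0 : 'rV[R]_0)
  | n'.+1 => lebesgue_rV_succ (lebesgue_rV R n')
  end.

Section euclidean.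
Context {R : realType} {d : nat}.
Implicit Types x y : 'rV[R]_d.

Definition dotp x y : R := \sum_(i < d) x ord0 i * y ord0 i.

(* The library norm `|x| on 'rV[R]_d is the max-norm. *)
Definition enorm x : R := Num.sqrt (dotp x x).

Definition e1 : 'rV[R]_d := \row_i (i == 0 :> nat)%:R.

End euclidean.

Definition Gamma {R : realType} (s : R) : R :=
  \int[lebesgue_measure]_(t in `]0, +oo[) (t `^ (s - 1) * expR (- t)).

Section kernel.
Context (R : realType) (d : nat).
Implicit Types (V : 'rV[R]_d -> R) (x y z w : 'rV[R]_d).

Definition Cd : R := Gamma (d%:R / 2 - 1) / (4 * pi `^ (d%:R / 2)).

(* In both integrals below the integrand is undefined on paper at z = x; here
   0^-1 = 0 makes it 0 at that point, which is Lebesgue-negligible. *)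
Definition neg_inv_laplacian_abs V x : \bar R :=
  (Cd%:E * \int[lebesgue_rV R d]_z (`|V z| / enorm (z - x) ^+ (d - 2))%:E)%E.

Definition inv_laplacian_norm V : \bar R :=
  ereal_sup (range (neg_inv_laplacian_abs V)).

Definition K x y : R :=
  expR (- (enorm x * enorm y - dotp x y) / 2) / enorm x ^+ (d - 2)
  * (1 + enorm x * enorm y) `^ (d%:R / 2 - 3 / 2).

Definition Knorm V : \bar R :=
  ereal_sup [set (\int[lebesgue_rV R d]_z (`|V z| * K (z - x) y)%:E)%E
            | x in setT & y in setT].

Definition half_dim_norm V : \bar R :=
  ('N[lebesgue_rV R d]_(d%:R / 2)%:E [EFin \o V])%E.

Definition kappa : \bar R :=
  ((\int[lebesgue_rV R d]_(w in [set w | (1 < enorm w)%R])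
     ((expR (- (enorm w - dotp w e1) / 2) * enorm w `^ (- ((d%:R - 1) / 2)))
        `^ (d%:R / (d%:R - 2)))%:E) `^ ((d%:R - 2) / d%:R))%E.

End kernel.

(* Main.v *)
(** Write [e = (d - 3) / 2].  Since [K w 0 = |w|^-(d-2)], taking [y = 0] gives
the lower bound.  For the upper bound, [1 + |w||y|] is at most [2] or at most
[2 |w||y|]; with [exp <= 1] in the first case (Cauchy-Schwarz),
  [K w y <= 2^e (|w|^-(d-2) + |y|^(d-2) G (|y| w))],
where [G u = exp (- (|u| - u . y/|y|) / 2) |u|^-((d-1)/2)] on [|u| > 1].
Hoelder's inequality with exponents [d/2] and [q = d/(d-2)] bounds the
contribution of the second term: by scaling and rotation invariance of the
Lebesgue measure, the [L^q] norm of [|y|^(d-2) G (|y| .)] is [kappa].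

For [kappa < oo], write [w = (x, v)] and [t = 1 + |x|].  Since
[|w| - x = |v|^2 / (|w| + x)], the integrand is at most
[C t^-(q(d-1)/2) exp (- c |v| / sqrt t)] where [|w| > 1].  Integrating over [v]
produces the factor [t^((d-1)/2)], and what remains is the integral of
[t^-((d-1)/(d-2))] over [x], which converges. *)
Require Import Defs.
From mathcomp Require Import all_boot all_order all_algebra.
From mathcomp Require Import all_classical all_reals all_analysis.
From mathcomp Require Import measurable_realfun ring lra.

Set Implicit Arguments.
Unset Strict Implicit.
Unset Printing Implicit Defensive.

Import Order.TTheory GRing.Theory Num.Theory.
Import numFieldNormedType.Exports.
Local Open Scope classical_set_scope.
Local Open Scope ring_scope.
Local Open Scope ereal_scope.

(** * Borel measurability in ['rV[R]_n] *)

Section measurability.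
Context {R : realType}.

Lemma measurable_coord n (i : 'I_n) :
  measurable_fun setT (fun v : 'rV[R]_n => v ord0 i).
Proof.
apply: (@measurability _ _ _ _ _ _ (@RGenOpens.G R)).
  exact: RGenOpens.measurableE.
move=> _ [_ [x [y ->]] <-]; rewrite setTI; apply: sub_sigma_algebra.
by apply: open_comp => [v _|]; [exact: coord_continuous|exact: interval_open].
Qed.

(** The sigma-algebra on ['rV[R]_n] is generated by the open sets, not defined as a product.
    Induction on [n] peels off one coordinate at a time, through the measurability of [rV_cons]. *)
Lemma measurable_fun_rV d (T : measurableType d) n (F : T -> 'rV[R]_n) :
  (forall i, measurable_fun setT (fun t => F t ord0 i)) -> measurable_fun setT F.
Proof.
elim: n F => [F _|n IH F mF].
  rewrite (_ : F = cst (0%R : 'rV[R]_0)); first exact: measurable_cst.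
  by apply/funext => t; apply/rowP => -[].
rewrite (_ : F = rV_cons \o
    (fun t => (F t ord0 ord0, \row_j F t ord0 (lift ord0 j)))); last first.
  apply/funext => t /=; apply/rowP => j.
  case: (unliftP ord0 j) => [k|] ->; last by rewrite rV_cons0.
  by rewrite rV_cons_lift mxE.
apply: measurableT_comp; first exact: measurable_rV_cons.
apply: measurable_fun_pair; first exact: mF.
apply: IH => i; rewrite (_ : (fun _ => _) = (fun t => F t ord0 (lift ord0 i))).
  exact: mF.
by apply/funext => t; rewrite mxE.
Qed.

Lemma measurable_dotp d (T : measurableType d) n (F G : T -> 'rV[R]_n) :
  measurable_fun setT F -> measurable_fun setT G ->
  measurable_fun setT (fun t => dotp (F t) (G t)).
Proof.
move=> mF mG; apply: measurable_sum => i; apply: measurable_funM.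
- exact: (measurableT_comp (measurable_coord i)).
- exact: (measurableT_comp (measurable_coord i)).
Qed.

Lemma measurable_enorm n : measurable_fun setT (@enorm R n).
Proof.
apply: (@measurableT_comp _ _ _ _ _ _ (@Num.sqrt R) _ (fun x => dotp x x)).
  by apply: continuous_measurable_fun; exact: sqrt_continuous.
exact: measurable_dotp.
Qed.

Lemma measurable_rV_affine n (a : R) (b : 'rV[R]_n) :
  measurable_fun setT (fun w : 'rV[R]_n => a *: w + b)%R.
Proof.
apply: measurable_fun_rV => i.
rewrite (_ : (fun _ => _) = (fun t : 'rV[R]_n => a * t ord0 i + b ord0 i)%R).
  by apply: measurable_funD => //; apply: measurable_funM => //;
    exact: measurable_coord.
by apply/funext => t; rewrite !mxE.
Qed.

End measurability.

(** * Affine changes of variable on the line *)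

Section lebesgue_R.
Context {R : realType}.
Local Notation mu := (@lebesgue_measure R).

(** Uniqueness of Lebesgue measure: [a] times the image of [mu] under [x -> a * x + b] agrees with
    [mu] on half-open intervals. *)
Lemma ge0_integral_affine (f : R -> \bar R) (a b : R) : (0 < a)%R ->
  measurable_fun setT f -> (forall x, 0 <= f x) ->
  \int[mu]_x f (a * x + b)%R = a^-1%:E * \int[mu]_x f x.
Proof.
move=> a0 mf f0.
pose T : measurableTypeR R -> measurableTypeR R := fun x => (a * x + b)%R.
have mT : measurable_fun setT T.
  by apply: measurable_funD => //; exact: measurable_funM.
pose nu : {measure set (measurableTypeR R) -> \bar R} :=
  mscale (NngNum (ltW a0)) (pushforward mu T : {measure set _ -> \bar R}).
have aT (A : set (measurableTypeR R)) : measurable A -> mu A = nu mT A.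
  apply: lebesgue_measure_unique A => _ [[u v] _ <-].
  rewrite /nu /= /mscale/= /pushforward.
  rewrite (_ : _ @^-1` _ =
    `]((u - b) / a)%R, ((v - b) / a)%R]%classic); last first.
    apply/seteqP; split=> x /=; rewrite !in_itv/= ltr_pdivrMr// ler_pdivlMr//;
      by rewrite ltrBlDr lerBrDr (mulrC x).
  rewrite !lebesgue_measure_itv/= !lte_fin.
  rewrite ltr_pM2r ?invr_gt0// ltrD2r.
  case: ifPn => _; last by rewrite mule0.
  by rewrite -!EFinB -EFinM; congr EFin; field; rewrite gt_eqF.
transitivity (\int[pushforward mu T]_x f x).
  by rewrite ge0_integral_pushforward// => x _; exact: f0.
rewrite [X in _ * X](eq_measure_integral (nu mT)).
  by rewrite ge0_integral_mscale//= muleA -EFinM mulVf ?mul1e// gt_eqF.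
by move=> A mA _; exact: aT.
Qed.

Lemma ge0_integral_shift (f : R -> \bar R) (b : R) :
  measurable_fun setT f -> (forall x, 0 <= f x) ->
  \int[mu]_x f (x + b)%R = \int[mu]_x f x.
Proof.
move=> mf f0; have := ge0_integral_affine b ltr01 mf f0.
by rewrite invr1 mul1e => <-; apply: eq_integral => x _; rewrite mul1r.
Qed.

Lemma ge0_integral_oppr (f : R -> \bar R) :
  measurable_fun setT f -> (forall x, 0 <= f x) ->
  \int[mu]_x f (- x)%R = \int[mu]_x f x.
Proof.
move=> mf f0.
pose N : measurableTypeR R -> measurableTypeR R := -%R.
have mN : measurable_fun setT N by exact: measurable_funN.
transitivity (\int[pushforward mu N]_x f x).
  by rewrite ge0_integral_pushforward// => x _; exact: f0.
by apply: eq_measure_integral => //= A mA _; exact: lebesgue_measureN.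
Qed.

End lebesgue_R.

(** * Tonelli and affine changes of variable in R^n *)

Section lebesgue_rV.
Context {R : realType}.
Local Notation mu := (@lebesgue_measure R).
Local Notation la n := (lebesgue_rV R n).

Section tonelli.
Context {n : nat} (f : 'rV[R]_n.+1 -> \bar R).
Hypotheses (mf : measurable_fun setT f) (f0 : forall w, 0 <= f w).

Let mfc : measurable_fun setT (f \o rV_cons).
Proof. by apply: measurableT_comp => //; exact: measurable_rV_cons. Qed.

Lemma integral_rV_prod :
  \int[la n.+1]_w f w = \int[mu \x la n]_p f (rV_cons p).
Proof.
by rewrite /= /lebesgue_rV_succ ge0_integral_pushforward//.
Qed.

Lemma integral_rV_cons1 :
  \int[la n.+1]_w f w = \int[mu]_x \int[la n]_w f (rV_cons (x, w)).
Proof.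
by rewrite integral_rV_prod (fubini_tonelli1 (f \o rV_cons))//= => p; exact: f0.
Qed.

Lemma integral_rV_cons2 :
  \int[la n.+1]_w f w = \int[la n]_w \int[mu]_x f (rV_cons (x, w)).
Proof.
by rewrite integral_rV_prod (fubini_tonelli2 (f \o rV_cons))//= => p; exact: f0.
Qed.

Lemma measurable_integral_rV_cons :
  measurable_fun setT (fun x => \int[la n]_w f (rV_cons (x, w))).
Proof.
by apply: (measurable_fun_fubini_tonelli_F (f \o rV_cons)) => //= p; exact: f0.
Qed.

End tonelli.

(** Induction by Tonelli: each coordinate contributes one factor [a^-1] through
    [ge0_integral_affine]. *)
Lemma ge0_integral_rV_affine n (f : 'rV[R]_n -> \bar R) (a : R) (b : 'rV[R]_n) :
  (0 < a)%R -> measurable_fun setT f -> (forall w, 0 <= f w) ->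
  \int[la n]_w f (a *: w + b)%R = (a ^- n)%:E * \int[la n]_w f w.
Proof.
move=> a0; elim: n f b => [|n IH] f b mf f0.
  rewrite expr0 invr1 mul1e; apply: eq_integral => w _; congr f.
  by apply/rowP => -[].
pose b' : 'rV[R]_n := (\row_j b ord0 (lift ord0 j))%R.
have mfa := measurableT_comp mf (measurable_rV_affine a b).
rewrite (integral_rV_cons1 mfa)//=.
have E x w : (a *: rV_cons (x, w) + b)%R
    = rV_cons (a * x + b ord0 ord0, a *: w + b')%R :> 'rV[R]_n.+1.
  apply/rowP => j; rewrite [in LHS]mxE [in LHS]mxE.
  case: (unliftP ord0 j) => [k|] ->; last by rewrite !rV_cons0.
  by rewrite !rV_cons_lift/= !mxE.
under eq_integral do under eq_integral do rewrite E.
have mfx x : measurable_fun setT (fun w : 'rV[R]_n => f (rV_cons (x, w))).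
  apply: measurableT_comp => //.
  exact: (measurableT_comp measurable_rV_cons (pair1_measurable x)).
under eq_integral do rewrite (IH (fun w => f (rV_cons (_, w))))//.
have mi := measurable_integral_rV_cons mf f0.
rewrite ge0_integralZl//; last 3 first.
- apply: (measurableT_comp mi).
  by apply: measurable_funD => //; exact: measurable_funM.
- by move=> x _; exact: integral_ge0.
- by rewrite lee_fin invr_ge0 exprn_ge0// ltW.
rewrite (ge0_integral_affine _ a0 mi)//; last by move=> x; exact: integral_ge0.
by rewrite -(integral_rV_cons1 mf)// muleA -EFinM exprSr invfM.
Qed.

(** The Jacobian stands inside the integral, the form in which it turns up in
    [Lnorm_paraboloid_tail]. *)
Lemma ge0_integral_rV_dilate n (f : 'rV[R]_n -> \bar R) (a : R) (b : 'rV[R]_n) :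
  (0 < a)%R -> measurable_fun setT f -> (forall w, 0 <= f w) ->
  \int[lebesgue_rV R n]_w ((a ^+ n)%R%:E * f (a *: w + b)%R) =
   \int[lebesgue_rV R n]_w f w.
Proof.
move=> a0 mf f0; rewrite ge0_integralZl.
- rewrite (ge0_integral_rV_affine b a0 mf f0) muleA -EFinM divff ?mul1e//.
  by rewrite expf_neq0// gt_eqF.
- exact: measurableT.
- exact: (measurableT_comp mf (measurable_rV_affine _ _)).
- by move=> w _; exact: f0.
- by rewrite lee_fin exprn_ge0// ltW.
Qed.

End lebesgue_rV.

(** * The Euclidean scalar product *)

Section dotp.
Context {R : realType}.
Local Open Scope ring_scope.

Section theory.
Context {n : nat}.
Implicit Types (x y z : 'rV[R]_n) (a : R).

Lemma dotpC x y : dotp x y = dotp y x.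
Proof. by apply: eq_bigr => i _; rewrite mulrC. Qed.

Lemma dotpDr x y z : dotp x (y + z) = dotp x y + dotp x z.
Proof. by rewrite -big_split; apply: eq_bigr => i _; rewrite mxE mulrDr. Qed.

Lemma dotpZr a x y : dotp x (a *: y) = a * dotp x y.
Proof. by rewrite mulr_sumr; apply: eq_bigr => i _; rewrite mxE mulrCA. Qed.

Lemma dotpDl x y z : dotp (x + y) z = dotp x z + dotp y z.
Proof. by rewrite dotpC dotpDr !(dotpC z). Qed.

Lemma dotpZl a x y : dotp (a *: x) y = a * dotp x y.
Proof. by rewrite dotpC dotpZr dotpC. Qed.

Lemma dotp_ge0 x : 0 <= dotp x x.
Proof. by apply: sumr_ge0 => i _; rewrite -expr2 sqr_ge0. Qed.

Lemma enorm_ge0 x : 0 <= enorm x.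
Proof. exact: sqrtr_ge0. Qed.

Lemma sqr_enorm x : enorm x ^+ 2 = dotp x x.
Proof. by rewrite sqr_sqrtr// dotp_ge0. Qed.

Lemma dotp_eq0 x : (dotp x x == 0) = (x == 0).
Proof.
apply/eqP/eqP => [|->]; last by apply: big1 => i _; rewrite mxE mul0r.
move=> /eqP; rewrite psumr_eq0 => [/allP h|i _]; last by rewrite -expr2 sqr_ge0.
apply/rowP => i; rewrite mxE; apply/eqP.
by have := h i (mem_index_enum _); rewrite mulf_eq0 orbb.
Qed.

Lemma enorm_eq0 x : (enorm x == 0) = (x == 0).
Proof. by rewrite -dotp_eq0 -sqr_enorm expf_eq0. Qed.

Lemma enorm0 : enorm (0 : 'rV[R]_n) = 0.
Proof. by apply/eqP; rewrite enorm_eq0. Qed.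

Lemma enormZ a x : 0 <= a -> enorm (a *: x) = a * enorm x.
Proof.
move=> a0; rewrite /enorm dotpZl dotpZr mulrA -expr2 sqrtrM ?sqr_ge0//.
by rewrite sqrtr_sqr ger0_norm.
Qed.

(** Cauchy-Schwarz: the square of [dotp x x *: y - dotp x y *: x] is nonnegative and equals [dotp x
    x * (dotp x x * dotp y y - dotp x y ^+ 2)]. *)
Lemma dotp_le x y : dotp x y <= enorm x * enorm y.
Proof.
have [->|x0] := eqVneq x 0.
  rewrite [leLHS]big1 ?mulr_ge0 ?enorm_ge0// => i _.
  by rewrite mxE mul0r.
have nx0 : 0 < dotp x x by rewrite lt0r dotp_eq0 x0 dotp_ge0.
rewrite (le_trans (ler_norm _))// -ler_sqr ?nnegrE ?mulr_ge0 ?enorm_ge0//.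
rewrite real_normK ?num_real// exprMn !sqr_enorm.
have := dotp_ge0 (dotp x x *: y - dotp x y *: x).
rewrite -scaleNr dotpDl !dotpDr !dotpZl !dotpZr (dotpC y x) => h.
have : 0 <= dotp x x * (dotp x x * dotp y y - dotp x y ^+ 2).
  by apply: (le_trans h); rewrite le_eqVlt; apply/orP; left; apply/eqP; ring.
by rewrite pmulr_rge0// subr_ge0.
Qed.

End theory.

Lemma dotp_cons n (p q : R * 'rV[R]_n) :
  dotp (rV_cons p) (rV_cons q) = p.1 * q.1 + dotp p.2 q.2.
Proof.
rewrite /dotp big_ord_recl !rV_cons0; congr +%R.
by apply: eq_bigr => i _; rewrite !rV_cons_lift.
Qed.

Lemma rV_unconsK n : cancel (@rV_uncons R n) rV_cons.
Proof.
move=> v; apply/rowP => j.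
case: (unliftP ord0 j) => [k|] ->; last by rewrite rV_cons0.
by rewrite rV_cons_lift mxE.
Qed.

Lemma dotp_e1 n (w : 'rV[R]_n.+1) : dotp w (@e1 R n.+1) = w ord0 ord0.
Proof.
rewrite /dotp big_ord_recl big1 ?addr0; first by rewrite mxE mulr1.
by move=> i _; rewrite mxE mulr0.
Qed.

End dotp.

(** * Rotation invariance of Lebesgue measure *)

Section rotation.
Context {R : realType}.
Local Notation mu := (@lebesgue_measure R).

(** Invariance is phrased through integrals of nonnegative functions, so that it passes to
    compositions by substitution. *)
Definition preserves_lebesgue n (T : 'rV[R]_n -> 'rV[R]_n) :=
  measurable_fun setT T /\
  forall f : 'rV[R]_n -> \bar R, measurable_fun setT f -> (forall w, 0 <= f w) ->
    \int[lebesgue_rV R n]_w f (T w) = \int[lebesgue_rV R n]_w f w.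

Lemma preserves_lebesgue_comp n (S T : 'rV[R]_n -> 'rV[R]_n) :
  preserves_lebesgue S -> preserves_lebesgue T -> preserves_lebesgue (S \o T).
Proof.
move=> [mS iS] [mT iT]; split=> [|f mf f0]; first exact: measurableT_comp.
by rewrite (iT (f \o S))/= ?iS//; exact: measurableT_comp.
Qed.

Section shear.
Context {n : nat}.

Definition shear_head (a : 'rV[R]_n) (v : 'rV[R]_n.+1) : 'rV[R]_n.+1 :=
  let p := rV_uncons v in rV_cons (p.1 + dotp a p.2, p.2)%R.

Definition shear_tail (b : 'rV[R]_n) (v : 'rV[R]_n.+1) : 'rV[R]_n.+1 :=
  let p := rV_uncons v in rV_cons (p.1, p.2 + p.1 *: b)%R.

Definition flip_head (v : 'rV[R]_n.+1) : 'rV[R]_n.+1 :=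
  let p := rV_uncons v in rV_cons (- p.1, p.2)%R.

Let m1 : measurable_fun setT (fun v : 'rV[R]_n.+1 => (rV_uncons v).1).
Proof. exact: measurable_coord. Qed.

Let m2 : measurable_fun setT (fun v : 'rV[R]_n.+1 => (rV_uncons v).2).
Proof.
exact: (measurableT_comp measurable_snd measurable_rV_uncons).
Qed.

Let mcons (F : 'rV[R]_n.+1 -> R) (G : 'rV[R]_n.+1 -> 'rV[R]_n) :
  measurable_fun setT F -> measurable_fun setT G ->
  measurable_fun setT (fun v => rV_cons (F v, G v)).
Proof.
move=> mF mG; apply: measurableT_comp; first exact: measurable_rV_cons.
exact: measurable_fun_pair.
Qed.

Let mfx (f : 'rV[R]_n.+1 -> \bar R) w : measurable_fun setT f ->
  measurable_fun setT (fun x => f (rV_cons (x, w))).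
Proof.
move=> mf; apply: measurableT_comp => //.
exact: (measurableT_comp measurable_rV_cons (pair2_measurable w)).
Qed.

Let mfw (f : 'rV[R]_n.+1 -> \bar R) x : measurable_fun setT f ->
  measurable_fun setT (fun w => f (rV_cons (x, w))).
Proof.
move=> mf; apply: measurableT_comp => //.
exact: (measurableT_comp measurable_rV_cons (pair1_measurable x)).
Qed.

(** For a fixed tail this shear is a translation of the line, so Tonelli is used with the head
    integrated first. *)
Lemma preserves_lebesgue_shear_head a : preserves_lebesgue (shear_head a).
Proof.
have mT : measurable_fun setT (shear_head a).
  apply: mcons => //; apply: measurable_funD => //.
  by apply: measurable_dotp.
split=> // f mf f0.
rewrite (integral_rV_cons2 mf f0).
rewrite [LHS](integral_rV_cons2 (measurableT_comp mf mT) (fun=> f0 _)).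
apply: eq_integral => w _; under eq_integral do rewrite /= /shear_head rV_consK/=.
by rewrite (ge0_integral_shift _ (mfx w mf)).
Qed.

(** Here the head [x] is fixed and the tail is translated by [x *: b], so the tail is integrated
    first. *)
Lemma preserves_lebesgue_shear_tail b : preserves_lebesgue (shear_tail b).
Proof.
have mT : measurable_fun setT (shear_tail b).
  apply: mcons => //; apply: measurable_fun_rV => i.
  rewrite (_ : (fun _ => _) = fun v : 'rV[R]_n.+1 =>
      ((rV_uncons v).2 ord0 i + (rV_uncons v).1 * b ord0 i)%R); last first.
    by apply/funext => v; rewrite !mxE.
  apply: measurable_funD; last exact: measurable_funM.
  exact: (measurableT_comp (measurable_coord i)).
split=> // f mf f0.
rewrite (integral_rV_cons1 mf f0).
rewrite [LHS](integral_rV_cons1 (measurableT_comp mf mT) (fun=> f0 _)).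
apply: eq_integral => x _; under eq_integral do rewrite /= /shear_tail rV_consK/=.
have := ge0_integral_rV_affine (x *: b)%R ltr01 (mfw x mf).
rewrite expr1n invr1 mul1e => <-//.
by apply: eq_integral => w _; rewrite scale1r.
Qed.

Lemma preserves_lebesgue_flip_head : preserves_lebesgue flip_head.
Proof.
have mT : measurable_fun setT flip_head.
  by apply: mcons => //; exact: measurable_funN.
split=> // f mf f0.
rewrite (integral_rV_cons2 mf f0).
rewrite [LHS](integral_rV_cons2 (measurableT_comp mf mT) (fun=> f0 _)).
apply: eq_integral => w _; under eq_integral do rewrite /= /flip_head rV_consK/=.
by rewrite (ge0_integral_oppr (mfx w mf)).
Qed.

End shear.

(* A plane rotation of angle t <> pi is a product of three shears, with
   parameters - tan (t / 2), sin t and - tan (t / 2). *)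
Lemma rotation_e1 n (y : 'rV[R]_n.+1) : dotp y y = 1%R ->
  exists T, [/\ preserves_lebesgue T, forall w, enorm (T w) = enorm w
    & forall w, dotp (T w) y = dotp w (@e1 R n.+1)].
Proof.
rewrite -{1 2}(rV_unconsK y) dotp_cons.
set c : R := (rV_uncons y).1; set b := (rV_uncons y).2 => cb.
(* The case [1 + c = 0] is the angle pi, where tan (t / 2) has no value; then [y = - e1], and
   reversing the head coordinate suffices. *)
have [cN1|c1] := eqVneq (1 + c)%R 0%R.
  have cE : c = (-1)%R by lra.
  have b0 : b = 0%R.
    by apply/eqP; rewrite -dotp_eq0; apply/eqP; move: cb; rewrite cE; lra.
  exists flip_head; split; first exact: preserves_lebesgue_flip_head.
    move=> w; rewrite /enorm -[w in RHS]rV_unconsK /flip_head !dotp_cons/=.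
    by rewrite mulrNN.
  move=> w; rewrite -(rV_unconsK y) /flip_head dotp_cons -/c -/b b0 cE dotp_e1.
  by rewrite -(scale0r 0%R) dotpZr mul0r addr0/= mulrN1 opprK.
(* With [c] = cos t and |b| = sin t, the formula tan (t / 2) = sin t / (1 + cos t) turns the outer
   shear parameter into [k *: b]. *)
pose k := (- (1 + c)^-1)%R.
exists (shear_head (k *: b) \o shear_tail b \o shear_head (k *: b)).
have bb : dotp b b = (1 - c ^+ 2)%R by rewrite -cb expr2 addrC addKr.
(* Closed form of the composite: it sends [e1] to [y] and fixes every vector orthogonal to both. *)
have E w : let p := rV_uncons w in let P := dotp b p.2 in
   (shear_head (k *: b) \o shear_tail b \o shear_head (k *: b)) w =
   rV_cons (c * p.1 - P, p.2 + (p.1 + k * P) *: b)%R.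
  rewrite /comp /shear_head /shear_tail !rV_consK; congr (rV_cons (_, _)).
  - by rewrite !dotpZl dotpDr dotpZr bb /k/=; field.
  - by rewrite dotpZl.
split.
- apply: preserves_lebesgue_comp (preserves_lebesgue_shear_head _).
  exact: preserves_lebesgue_comp (preserves_lebesgue_shear_head _)
    (preserves_lebesgue_shear_tail _).
- move=> w; rewrite E /enorm; congr Num.sqrt.
  rewrite -[w in RHS]rV_unconsK !dotp_cons/= dotpDl !dotpDr !dotpZl !dotpZr bb.
  by rewrite (dotpC _ b) /k; field.
- move=> w; rewrite E -(rV_unconsK y) dotp_cons -/c -/b dotpDl dotpZl bb dotp_e1.
  by rewrite /= (dotpC _ b) /k; field.
Qed.

End rotation.

(** * Integrability of powers and exponentials at infinity *)

Section decay.
Context {R : realType}.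
Local Notation mu := (@lebesgue_measure R).
Local Open Scope ring_scope.

(** Raise [1 + t <= c + t <= c * expR (t / c)] to the power [c]. This compares exponential with
    polynomial decay, here and for the Gamma integral. *)
Lemma powR1D_le_expR (c t : R) : 1 <= c -> 0 <= t ->
  (1 + t) `^ c <= c `^ c * expR t.
Proof.
move=> c1 t0; have c0 : 0 < c by exact: lt_le_trans c1.
have -> : expR t = expR (t / c) `^ c by rewrite -expRM divfK// gt_eqF.
rewrite -powRM ?expR_ge0 ?(ltW c0)//.
apply: ge0_ler_powR; rewrite ?nnegrE ?(ltW c0)//.
- by rewrite addr_ge0.
- by rewrite mulr_ge0 ?expR_ge0 ?(ltW c0).
- rewrite -ler_pdivrMl//; apply: le_trans (expR_ge1Dx _).
  by rewrite mulrDr mulr1 mulrC lerD2r invf_le1.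
Qed.

Lemma continuous_powR1Dnorm (p : R) :
  continuous (fun x : R => (1 + `|x|) `^ (- p)).
Proof.
move=> x.
apply: (@continuous_comp _ _ _ (fun x : R => 1 + `|x|) (@powR R ^~ (- p))).
  by apply: continuousD; [exact: cst_continuous|exact: norm_continuous].
apply: differentiable_continuous; apply/derivable1_diffP.
by apply: derivable_powR; rewrite in_itv/= andbT ltr_pwDl.
Qed.

(** The integrand is even, and on the half-line it has an explicit primitive that vanishes at
    infinity because [1 < p]. *)
Lemma integral_powR_lty (p : R) : 1 < p ->
  (\int[mu]_x ((1 + `|x|) `^ (- p))%:E < +oo)%E.
Proof.
move=> p1; have p0 : 1 - p != 0 by rewrite subr_eq0 lt_eqF.
rewrite (@ge0_symfun_integralT _ (fun x : R => (1 + `|x|) `^ (- p))); last 3 first.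
- by move=> x; exact: powR_ge0.
- exact: continuous_powR1Dnorm.
- by move=> x /=; rewrite normrN.
pose F (x : R) := (1 - p)^-1 * (1 + x) `^ (1 - p).
have dF (x : R) : 0 <= x -> is_derive x 1 F ((1 + `|x|) `^ (- p)).
  move=> x0; have x1 : 0 < 1 + x by rewrite ltr_pwDl.
  have := is_derive1_powR (1 - p) x1 => d1.
  have d2 : is_derive x 1 (fun x : R => 1 + x) 1.
    by have := is_deriveD (is_derive_cst (1 : R^o) x (1 : R^o))
      (is_derive_id x (1 : R^o));
      rewrite add0r.
  have d3 := @is_derive1_comp _ (@powR R ^~ (1 - p)) (fun x => 1 + x) x _ _ d1 d2.
  have d4 := @is_deriveZ _ _ _ _ (1 - p)^-1 _ _ _ d3.
  apply: is_derive_eq d4 _.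
  rewrite /GRing.scale/= mulr1 ger0_norm// mulrA mulVf// mul1r.
  by congr powR; ring.
rewrite -set_itvcy.
rewrite (@ge0_continuous_FTC2y _ _ F 0 0).
- by rewrite -EFinB -EFinM ltry.
- by move=> x _; exact: powR_ge0.
- exact/continuous_subspaceT/continuous_powR1Dnorm.
- rewrite -(mulr0 (1 - p)^-1); apply: cvgMr.
  (* The negative power of [1 + x] becomes a positive power of [(1 + x)^-1], which tends to 0 from
     the right. *)
  apply: (@cvg_trans _ ((((1 + x)^-1) `^ (p - 1)) @[x --> +oo])).
    apply: near_eq_cvg; near=> x.
    have x0 : 0 < 1 + x by rewrite ltr_pwDl//; near: x; exact: nbhs_pinfty_ge.
    by rewrite -powR_inv1 ?(ltW x0)// -powRrM; congr powR; ring.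
  apply: (@cvg_comp _ _ _ (fun x : R => (1 + x)^-1)
    (@powR R ^~ (p - 1)) _ (0^'+)).
    have c0 : (1 + x)^-1 @[x --> +oo] --> (0 : R).
      apply/gtr0_cvgV0; last exact: cvg_addrl.
      by near=> x; rewrite ltr_pwDl//; near: x; exact: nbhs_pinfty_ge.
    move=> A /c0; apply: filterS2 (nbhs_pinfty_ge (num_real 0)) => x x0.
    by apply; rewrite invr_gt0 ltr_pwDl.
  by apply: powR_cvg0; rewrite subr_gt0.
- by move=> x x0; apply: ex_derive; exact: dF (ltW x0).
- apply: cvg_at_right_filter; apply: differentiable_continuous.
  by apply/derivable1_diffP; apply: ex_derive; exact: dF.
- move=> x; rewrite in_itv/= andbT => x0.
  by rewrite derive1E; have [_ ->] := dF x (ltW x0).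
Unshelve. all: by end_near. Qed.

Lemma measurable_expN b :
  measurable_fun setT (fun x : R => expR (- (b * `|x|))).
Proof.
apply: measurableT_comp => //; apply: measurable_funN.
by apply: measurable_funM => //; exact: normr_measurable.
Qed.

(** Rescaling reduces to [b = 1], where a multiple of (1 + |x|)^-2 dominates. *)
Lemma integral_expR_norm_lty (b : R) : 0 < b ->
  (\int[mu]_x (expR (- (b * `|x|)))%:E < +oo)%E.
Proof.
move=> b0.
(* This is [powR1D_le_expR] with c = 2, whence the constant. *)
have bnd (x : R) : expR (- `|x|) <= 2 `^ 2 * (1 + `|x|) `^ (- 2).
  rewrite expRN powRN ler_pdivlMr ?powR_gt0 ?ltr_pwDl// mulrC.
  rewrite ler_pdivrMr ?expR_gt0//.
  by apply: powR1D_le_expR => //; rewrite ler1n.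
have me : measurable_fun setT (fun x : R => (expR (- `|x|))%:E).
  apply/measurable_EFinP; rewrite (_ : (fun _ => _) =
    (fun x : R => expR (- (1 * `|x|)))); first exact: measurable_expN.
  by apply/funext => x; rewrite mul1r.
have E : (\int[mu]_x (expR (- (b * `|x|)))%:E =
    b^-1%:E * \int[mu]_x (expR (- `|x|))%:E)%E.
  rewrite -(ge0_integral_affine 0 b0 me (fun=> expR_ge0 _)).
  by apply: eq_integral => x _; rewrite addr0 normrM gtr0_norm.
rewrite E lte_mul_pinfty ?lee_fin ?invr_ge0 ?ltW//.
have md : measurable_fun setT (fun x : R => ((1 + `|x|) `^ (- 2))%:E).
  by apply/measurable_EFinP; apply: continuous_measurable_fun; exact: continuous_powR1Dnorm.
apply: (@le_lt_trans _ _ (\int[mu]_x ((2 `^ 2)%:E * ((1 + `|x|) `^ (- 2))%:E))%E).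
  apply: ge0_le_integral => //.
  - by apply: measurable_funeM.
  - by move=> x _; rewrite -EFinM lee_fin.
rewrite ge0_integralZl//=.
rewrite lte_mul_pinfty ?lee_fin ?powR_ge0// integral_powR_lty// ltr1n//.
Qed.

(** Since |(x, v)| >= (|x| + |v|) / 2, the integrand is dominated by a product of exponentials of
    rate [b / 2]. The rate changes from one dimension to the next, so the induction keeps [b]
    general. *)
Lemma integral_expR_enorm_lty n (b : R) : 0 < b ->
  (\int[lebesgue_rV R n]_w (expR (- (b * enorm w)))%:E < +oo)%E.
Proof.
have mexp m c : measurable_fun setT
    (fun w : 'rV[R]_m => (expR (- (c * enorm w)))%:E).
  apply/measurable_EFinP; apply: measurableT_comp => //.
  apply: measurable_funN; apply: measurable_funM => //.
  exact: measurable_enorm.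
elim: n b => [|n IH] b b0.
  by rewrite /lebesgue_rV integral_dirac// diracT mul1e ltry.
rewrite (integral_rV_cons1 (mexp _ _)); last by move=> w; rewrite lee_fin expR_ge0.
have h0 : 0 < b / 2 by rewrite divr_gt0.
have ineq (x : R) (v : 'rV[R]_n) :
    expR (- (b * enorm (rV_cons (x, v)))) <=
    expR (- (b / 2 * `|x|)) * expR (- (b / 2 * enorm v)).
  rewrite -expRD ler_expR -opprD lerN2 -mulrDr -mulrA ler_pM2l//.
  rewrite ler_pdivrMl// mulr2n mulrDl mul1r.
  by rewrite lerD// -ler_sqr ?nnegrE ?enorm_ge0// sqr_enorm ?real_normK ?num_real//
    ?sqr_enorm dotp_cons/= -expr2 ?lerDl ?lerDr ?sqr_ge0 ?dotp_ge0.
set J := (\int[lebesgue_rV R n]_w (expR (- (b / 2 * enorm w)))%:E)%E.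
have Joo : (J < +oo)%E by exact: IH.
have J0 : (0 <= J)%E by apply: integral_ge0 => w _; rewrite lee_fin expR_ge0.
have le_J (x : R) : (\int[lebesgue_rV R n]_w
      (expR (- (b * enorm (rV_cons (x, w)))))%:E <=
    J * (expR (- (b / 2 * `|x|)))%:E)%E.
  rewrite muleC -ge0_integralZl.
  - apply: ge0_le_integral.
    + exact: measurableT.
    + by move=> w _; rewrite lee_fin expR_ge0.
    + apply: (measurableT_comp (mexp _ _)).
      exact: (measurableT_comp measurable_rV_cons (pair1_measurable x)).
    + exact: (measurable_funeM _ (mexp _ _)).
    + by move=> w _; rewrite -EFinM lee_fin.
  - exact: measurableT.
  - exact: mexp.
  - by move=> w _; rewrite lee_fin expR_ge0.
  - by rewrite lee_fin expR_ge0.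
have mcons := measurable_integral_rV_cons (mexp n.+1 b)
  (fun=> expR_ge0 _ : (0 <= _%:E)%E).
have m1 : measurable_fun setT (fun x : R => (expR (- (b / 2 * `|x|)))%:E).
  by apply/measurable_EFinP; exact: measurable_expN.
move: J Joo J0 le_J => J Joo J0 le_J.
apply: (@le_lt_trans _ _ (\int[mu]_x (J * (expR (- (b / 2 * `|x|)))%:E))%E).
  apply: ge0_le_integral.
  - exact: measurableT.
  - by move=> x _; apply: integral_ge0 => w _; rewrite lee_fin expR_ge0.
  - exact: mcons.
  - exact: (measurable_funeM J m1).
  - by move=> x _; exact: le_J.
rewrite ge0_integralZl//.
by rewrite lte_mul_pinfty ?integral_expR_norm_lty// ge0_fin_numE.
Qed.

End decay.

(** * Positivity of C_d *)

Section constants.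
Context {R : realType}.
Local Notation mu := (@lebesgue_measure R).
Local Open Scope ring_scope.

Lemma Gamma_gt0 (s : R) : 1 <= s -> 0 < Gamma s.
Proof.
move=> s1; pose f (t : R) := t `^ (s - 1) * expR (- t).
have f0 t : 0 <= f t by rewrite mulr_ge0 ?powR_ge0 ?expR_ge0.
have mf (D : set R) : measurable_fun D (fun t => (f t)%:E).
  apply: measurable_funTS.
  apply/measurable_EFinP; apply: measurable_funM; first exact: measurable_powR.
  by apply: measurableT_comp => //; exact: measurable_funN.
have c1 : 1 <= s + 1 by rewrite lerDr (le_trans _ s1).
(* [Gamma] is the [fine] of an extended integral, which would be 0 for a divergent one, so
   positivity requires convergence. *)
have foo : (\int[mu]_(t in `]0%R, +oo[) (f t)%:E < +oo)%E.
  (* From t^(s-1) (1 + t)^2 <= (1 + t)^(s+1) and [powR1D_le_expR] with c = s + 1. *)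
  pose g (t : R) := (((s + 1) `^ (s + 1))%:E * ((1 + `|t|) `^ (- 2))%:E)%E.
  have g0 t : (0 <= g t)%E by rewrite /g -EFinM lee_fin mulr_ge0 ?powR_ge0.
  have md : measurable_fun setT (fun x : R => ((1 + `|x|) `^ (- 2))%:E).
    apply/measurable_EFinP; apply: continuous_measurable_fun; exact: continuous_powR1Dnorm.
  have mg : measurable_fun setT g by exact: measurable_funeM.
  apply: (@le_lt_trans _ _ (\int[mu]_(t in `]0%R, +oo[) g t)%E).
    apply: ge0_le_integral.
    - exact: measurable_itv.
    - by move=> t _; rewrite lee_fin.
    - exact: mf.
    - exact: (measurable_funTS mg).
    - move=> t /=; rewrite in_itv/= andbT => t0.
      have t1 : 0 < 1 + t by rewrite ltr_pwDl// ltW.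
      rewrite /g -EFinM lee_fin gtr0_norm// powRN ler_pdivlMr ?powR_gt0//.
      rewrite /f expRN mulrAC ler_pdivrMr ?expR_gt0//.
      apply: le_trans (powR1D_le_expR c1 (ltW t0)).
      have -> : s + 1 = (s - 1) + 2 by ring.
      rewrite [leRHS]powRD; last by rewrite (gt_eqF t1) implybT.
      rewrite ler_wpM2r ?powR_ge0//.
      by apply: ge0_ler_powR; rewrite ?nnegrE ?subr_ge0 ?(ltW t0) ?(ltW t1) ?lerDr.
  apply: (@le_lt_trans _ _ (\int[mu]_t g t)%E).
    by apply: ge0_subset_integral.
  rewrite ge0_integralZl//; last by rewrite lee_fin powR_ge0.
  by rewrite lte_mul_pinfty ?lee_fin ?powR_ge0// integral_powR_lty// ltr1n.
apply: fine_gt0; apply/andP; split; last exact: foo.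
(* On [1, 2] the power is at least 1, because [1 <= s], and the exponential at least exp (-2). *)
apply: (@lt_le_trans _ _ (\int[mu]_(t in `[1%R, 2%R]) (expR (- 2)%R)%:E)%E).
  rewrite integral_cst//= lebesgue_measure_itv/= lte_fin ltr1n -EFinB -EFinM.
  by rewrite lte_fin mulr_gt0 ?expR_gt0// subr_gt0 ltr1n.
apply: (@le_trans _ _ (\int[mu]_(t in `[1%R, 2%R]) (f t)%:E)%E).
  apply: ge0_le_integral.
  - exact: measurable_itv.
  - by move=> t _; rewrite lee_fin expR_ge0.
  - exact: measurable_cst.
  - exact: mf.
  move=> t /=; rewrite in_itv/= => /andP[t1 t2].
  rewrite lee_fin -[leLHS]mul1r /f ler_pM ?expR_ge0//.
    by rewrite -[leLHS](powRr0 t) ler_powR// subr_ge0.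
  by rewrite ler_expR lerN2.
apply: ge0_subset_integral.
- exact: measurable_itv.
- exact: measurable_itv.
- exact: mf.
- by move=> t _; rewrite lee_fin.
move=> t /=; rewrite !in_itv/= andbT => /andP[t1 _].
exact: lt_le_trans t1.
Qed.

Lemma Cd_gt0 d : (4 <= d)%N -> 0 < Cd R d.
Proof.
move=> d4; rewrite divr_gt0 ?mulr_gt0 ?powR_gt0 ?pi_gt0// Gamma_gt0//.
have : (4 : R) <= d%:R by rewrite (ler_nat R 4).
lra.
Qed.

End constants.

(** * Finiteness of kappa *)

Section kappa.
Context {R : realType}.
Local Open Scope ring_scope.

(** The function G of the overview without its cutoff, with [y] in place of y/|y|. For [y = e1] its
    power d/(d-2) is the integrand of [kappa]. *)
Definition paraboloid_profile d (y w : 'rV[R]_d) : R :=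
  expR (- (enorm w - dotp w y) / 2) * enorm w `^ (- ((d%:R - 1) / 2)).

Lemma measurable_paraboloid_profile d (y : 'rV[R]_d) :
  measurable_fun setT (paraboloid_profile y).
Proof.
apply: measurable_funM.
  apply: measurableT_comp => //; apply: measurable_funM => //.
  apply: measurable_funN; apply: measurable_funB; first exact: measurable_enorm.
  by apply: measurable_dotp.
apply: (@measurableT_comp _ _ _ _ _ _ (@powR R ^~ _)) => //.
exact: measurable_enorm.
Qed.

Lemma measurable_enorm_gt1 d : measurable [set w : 'rV[R]_d | 1 < enorm w].
Proof.
rewrite (_ : [set _ | _] = setT `&` enorm @^-1` `]1, +oo[).
  exact: measurable_enorm.
by apply/seteqP; split => w /=; rewrite in_itv/= andbT// => -[].
Qed.

(* |w| - x = |v|^2 / (|w| + x) and |w| + x <= 2 (s^2 + |v|). *)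
Lemma enormB_head_ge n (x : R) (v : 'rV[R]_n) :
  (enorm v / Num.sqrt (1 + `|x|) - 1) / 4 <= enorm (rV_cons (x, v)) - x.
Proof.
set s := Num.sqrt _; set w := rV_cons _.
have s2 : s ^+ 2 = 1 + `|x| by rewrite sqr_sqrtr// addr_ge0.
have s1 : 1 <= s by rewrite -sqrtr1 ler_wsqrtr// lerDl.
have := enorm_ge0 v; have := enorm_ge0 w.
have : enorm w ^+ 2 = x ^+ 2 + enorm v ^+ 2.
  by rewrite !sqr_enorm dotp_cons expr2.
set r := enorm w; set p := enorm v => rE r0 p0.
have xr : `|x| <= r.
  by rewrite -ler_sqr ?nnegrE// real_normK ?num_real// rE lerDl sqr_ge0.
have rp : r <= `|x| + p.
  rewrite -ler_sqr ?nnegrE ?addr_ge0// rE sqrrD real_normK ?num_real//.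
  by rewrite -addrA lerD2l lerDr mulrn_wge0 ?mulr_ge0.
have xx : x <= `|x| by exact: ler_norm.
have h : p ^+ 2 <= (r - x) * (2 * (s ^+ 2 + p)).
  have -> : p ^+ 2 = (r - x) * (r + x) by rewrite -subr_sqr rE addrC addKr.
  by apply: ler_wpM2l; [lra|rewrite s2; lra].
have sp : 0 < s ^+ 2 + p by rewrite ltr_pwDl// exprn_gt0// (lt_le_trans _ s1).
have s0 : 0 < s by exact: lt_le_trans s1.
rewrite -(@ler_pM2r _ (2 * (s ^+ 2 + p))) ?mulr_gt0//; apply: le_trans h.
have -> : (p / s - 1) / 4 * (2 * (s ^+ 2 + p)) = (p - s) * (s ^+ 2 + p) / (2 * s).
  by field; rewrite gt_eqF.
rewrite ler_pdivrMr ?mulr_gt0//.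
rewrite -subr_ge0.
(* Completing the square in [p] makes every term nonnegative; the first one uses [1 <= s]. *)
have -> : p ^+ 2 * (2 * s) - (p - s) * (s ^+ 2 + p) =
  (s - 1) * p ^+ 2 + s * ((p - s / 2) ^+ 2 + 3 / 4 * s ^+ 2 + p) by field.
apply: addr_ge0; first by rewrite mulr_ge0 ?subr_ge0 ?sqr_ge0.
apply: mulr_ge0; first exact: ltW.
by rewrite !addr_ge0 ?sqr_ge0// mulr_ge0 ?sqr_ge0.
Qed.

Lemma kappa_lty d : (4 <= d)%N -> (kappa R d < +oo)%E.
Proof.
case: d => // n; rewrite ltnS => n3.
have n3R : (3 : R) <= n%:R by rewrite (ler_nat R 3).
rewrite /kappa; apply: poweR_lty.
set q : R := n.+1%:R / (n.+1%:R - 2).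
pose D := [set w : 'rV[R]_n.+1 | 1 < enorm w].
have dE : n.+1%:R = n%:R + 1 :> R by rewrite -natr1.
have q0 : 0 < q by rewrite /q dE divr_gt0//; lra.
(* Here d = n + 1, so [a] is [q] times the decay exponent (d-1)/2. *)
pose a : R := q * (n%:R / 2).
have a0 : 0 < a by rewrite mulr_gt0// divr_gt0//; lra.
(* The exponential absorbs the -1 in [enormB_head_ge]; the power of 2 comes from 1 + |x| <= 2 |w| on
   [D]. *)
pose C : R := expR (q / 8) * 2 `^ a.
have C0 : 0 <= C by rewrite mulr_ge0 ?expR_ge0 ?powR_ge0.
pose t (x : R) := 1 + `|x|.
have t0 x : 0 < t x by rewrite ltr_pwDl.
pose E (v : 'rV[R]_n) := expR (- (q / 8 * enorm v)).
pose s x := t x `^ (- 2^-1).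
have s0 x : 0 < s x by rewrite powR_gt0.
have sE x : s x = (Num.sqrt (t x))^-1.
  by rewrite /s powRN powR12_sqrt// ltW.
pose B (p : R * 'rV[R]_n) : R := C * t p.1 `^ (- a) * E (s p.1 *: p.2).
have mE : measurable_fun setT E.
  apply: measurableT_comp => //; apply: measurable_funN.
  by apply: measurable_funM => //; exact: measurable_enorm.
have mt : measurable_fun setT t.
  by apply: measurable_funD => //; exact: normr_measurable.
have mB : measurable_fun setT (fun w : 'rV[R]_n.+1 => (B (rV_uncons w))%:E).
  have mh : measurable_fun setT (fun w : 'rV[R]_n.+1 => t (rV_uncons w).1).
    exact: (measurableT_comp mt (measurable_coord ord0)).
  have mpow r : measurable_fun setT
      (fun w : 'rV[R]_n.+1 => t (rV_uncons w).1 `^ r).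
    exact: (measurableT_comp (measurable_powR r) mh).
  apply/measurable_EFinP; apply: measurable_funM; first exact: measurable_funM.
  apply: (measurableT_comp mE); apply: measurable_fun_rV => i.
  rewrite (_ : (fun _ => _) = fun w : 'rV[R]_n.+1 =>
      s (rV_uncons w).1 * w ord0 (lift ord0 i)); last first.
    by apply/funext => w; rewrite !mxE.
  by apply: measurable_funM; [exact: mpow|exact: measurable_coord].
have leB w : D w -> paraboloid_profile e1 w `^ q <= B (rV_uncons w).
  rewrite -[w in D w]rV_unconsK -[w in paraboloid_profile _ w]rV_unconsK.
  case: (rV_uncons w) => x v; rewrite /D/= => w1.
  rewrite /paraboloid_profile dotp_e1 rV_cons0/= powRM ?expR_ge0 ?powR_ge0//.
  have w0 : 0 < enorm (rV_cons (x, v)) by exact: lt_trans w1.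
  have sv : 0 < Num.sqrt (t x) by rewrite sqrtr_gt0.
  rewrite -expRM -powRrM /B/=.
  have -> : C * t x `^ (- a) * E (s x *: v) =
    expR (q / 8) * E (s x *: v) * (2 `^ a * t x `^ (- a)) by rewrite /C; ring.
  have -> : - ((n.+1%:R - 1) / 2) * q = - a :> R by rewrite /a dE; ring.
  apply: ler_pM; rewrite ?expR_ge0 ?powR_ge0//.
    rewrite -expRD ler_expR enormZ ?(ltW (s0 _))// sE.
    have := enormB_head_ge x v; rewrite -/(t x).
    set r := enorm _ - x; rewrite (mulrC _ (enorm v)); set m := enorm v / _ => h.
    have -> : - r / 2 * q = q * (- r / 2) by ring.
    have -> : q / 8 - q / 8 * m = q * ((1 - m) / 8) by field.
    rewrite ler_pM2l//; lra.
  rewrite !powRN ler_pdivlMr ?powR_gt0// mulrC ler_pdivrMr ?powR_gt0//.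
  rewrite -powRM ?(ltW w0)//; apply: ge0_ler_powR; rewrite ?nnegrE ?(ltW a0)//.
  - exact: ltW.
  - by rewrite mulr_ge0// ltW.
  - have : `|x| <= enorm (rV_cons (x, v)).
      rewrite -ler_sqr ?nnegrE ?(ltW w0)// sqr_enorm dotp_cons/=.
      by rewrite real_normK ?num_real// expr2 lerDl dotp_ge0.
    rewrite /t; lra.
have mD : measurable D by exact: measurable_enorm_gt1.
have B0 p : 0 <= B p.
  by rewrite /B mulr_ge0 ?expR_ge0// mulr_ge0 ?powR_ge0.
pose J := (\int[lebesgue_rV R n]_v (E v)%:E)%E.
have Joo : (J < +oo)%E by apply: integral_expR_enorm_lty; rewrite divr_gt0.
have J0 : (0 <= J)%E by apply: integral_ge0 => v _; rewrite lee_fin expR_ge0.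
(* Rescaling the tail produces s^-n = t^(n/2). The exponent left over is n/(n-1) = (d-1)/(d-2),
   which exceeds 1. *)
pose p : R := a - n%:R / 2.
have p1 : 1 < p.
  have -> : p = n%:R / (n%:R - 1).
    by rewrite /p /a /q dE; field; rewrite gt_eqF//; lra.
  by rewrite ltr_pdivlMr ?subr_gt0; lra.
apply: (@le_lt_trans _ _
    (\int[lebesgue_rV R n.+1]_(w in D) (B (rV_uncons w))%:E)%E).
  apply: ge0_le_integral.
  - exact: mD.
  - by move=> w _; rewrite lee_fin powR_ge0.
  - apply: measurable_funTS; apply/measurable_EFinP.
    exact: (measurableT_comp (measurable_powR _)
      (measurable_paraboloid_profile _)).
  - exact: (measurable_funTS mB).
  - by move=> w Dw; rewrite lee_fin; exact: leB.
(* Since [t] is at least 1, [B] has no singularity at the origin, and the domain can grow from [D]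
   to the whole space. *)
apply: (@le_lt_trans _ _ (\int[lebesgue_rV R n.+1]_w (B (rV_uncons w))%:E)%E).
  apply: ge0_subset_integral.
  - exact: mD.
  - exact: measurableT.
  - exact: mB.
  - by move=> w _; rewrite lee_fin.
  - exact: subsetT.
rewrite (integral_rV_cons1 mB); last by move=> w; rewrite lee_fin.
have inner x : (\int[lebesgue_rV R n]_v (B (rV_uncons (rV_cons (x, v))))%:E =
    C%:E * J * (t x `^ (- p))%:E)%E.
  under eq_integral do rewrite rV_consK /B/= EFinM.
  have mEE : measurable_fun setT (fun v : 'rV[R]_n => (E v)%:E).
    exact/measurable_EFinP.
  have EJ : (\int[lebesgue_rV R n]_v (E (s x *: v))%:E = (s x ^- n)%:E * J)%E.
    rewrite -(ge0_integral_rV_affine 0 (s0 x) mEE (fun=> expR_ge0 _)).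
    by apply: eq_integral => v _; rewrite addr0.
  rewrite ge0_integralZl.
  - rewrite EJ muleA -EFinM [RHS]muleAC -EFinM; congr (_%:E * _)%E.
    rewrite -mulrA; congr (_ * _).
    rewrite -powR_mulrn ?powR_ge0// -powRrM -powRN -powRD; last first.
      by rewrite (gt_eqF (t0 x)) implybT.
    by congr powR; rewrite /p; field.
  - exact: measurableT.
  - have := measurableT_comp mEE (measurable_rV_affine (s x) 0).
    by congr measurable_fun; apply/funext => v /=; rewrite addr0.
  - by move=> v _; rewrite lee_fin expR_ge0.
  - by rewrite lee_fin mulr_ge0 ?powR_ge0.
under eq_integral do rewrite inner.
have md : measurable_fun setT (fun x : R => (t x `^ (- p))%:E).
  by apply/measurable_EFinP; apply: continuous_measurable_fun;
    exact: continuous_powR1Dnorm.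
rewrite ge0_integralZl.
- rewrite lte_mul_pinfty ?mule_ge0 ?lee_fin ?integral_powR_lty//.
  by rewrite fin_numM// ge0_fin_numE.
- exact: measurableT.
- exact: md.
- by move=> x _; rewrite lee_fin powR_ge0.
- by rewrite mule_ge0 ?lee_fin.
Qed.

End kappa.

(** * Pointwise bound on the kernel, and the L^q norm of its second term *)

Section kernel_bound.
Context {R : realType}.
Local Open Scope ring_scope.

(** The value 0 on the unit ball replaces a restricted domain of integration, so that Hoelder's
    inequality applies on the whole space. *)
Definition paraboloid_tail d (y w : 'rV[R]_d) : R :=
  if 1 < enorm w then paraboloid_profile y w else 0.

Lemma paraboloid_tail_ge0 d (y w : 'rV[R]_d) : 0 <= paraboloid_tail y w.
Proof.
by rewrite /paraboloid_tail; case: ifP => // _; rewrite mulr_ge0 ?expR_ge0 ?powR_ge0.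
Qed.

Lemma measurable_paraboloid_tail d (y : 'rV[R]_d) :
  measurable_fun setT (paraboloid_tail y).
Proof.
apply: measurable_fun_ifT => //; last exact: measurable_paraboloid_profile.
by apply: measurable_fun_ltr => //; exact: measurable_enorm.
Qed.

Lemma K_ge0 d (w y : 'rV[R]_d) : 0 <= K w y.
Proof.
by rewrite mulr_ge0 ?powR_ge0// divr_ge0 ?expR_ge0 ?exprn_ge0 ?enorm_ge0.
Qed.

Lemma measurable_K d (y : 'rV[R]_d) : measurable_fun setT (fun w => K w y).
Proof.
have mn := @measurable_enorm R d.
apply: measurable_funM; last first.
  apply: (@measurableT_comp _ _ _ _ _ _ (@powR R ^~ _)) => //.
  by apply: measurable_funD => //; apply: measurable_funM.
apply: measurable_funM.
  apply: measurableT_comp => //; apply: measurable_funM => //.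
  apply: measurable_funN; apply: measurable_funB; first exact: measurable_funM.
  exact: measurable_dotp.
(* The identity with a negative [powR] also holds at [w = 0], by the conventions for [powR] and for
   the inverse of 0. *)
rewrite (_ : (fun _ => _) = fun w : 'rV[R]_d => enorm w `^ (- (d - 2)%:R)).
  exact: (measurableT_comp (measurable_powR _) mn).
by apply/funext => w; rewrite powR_invn// enorm_ge0.
Qed.

(** This is the Newtonian kernel without C_d. It yields the lower bound and also the measurability
    of that kernel. *)
Lemma K0r d (w : 'rV[R]_d) : K w 0 = (enorm w ^+ (d - 2))^-1.
Proof.
rewrite /K enorm0 mulr0 /dotp big1 => [|i _]; last by rewrite mxE mulr0.
by rewrite subr0 oppr0 mul0r expR0 addr0 powR1 mulr1 div1r.
Qed.

Lemma K_le d (w y : 'rV[R]_d) : (4 <= d)%N ->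
  K w y <= 2 `^ ((d%:R - 3) / 2) * ((enorm w ^+ (d - 2))^-1
    + enorm y ^+ (d - 2)
      * paraboloid_tail ((enorm y)^-1 *: y) (enorm y *: w)).
Proof.
move=> d4; have d4R : (4 : R) <= d%:R by rewrite (ler_nat R 4).
(* At the origin the left side is 0, because [d - 2] is positive and the inverse of 0 is 0. *)
have [->|w0] := eqVneq w 0.
  rewrite /K enorm0 expr0n subn_eq0 leqNgt (leq_trans _ d4)//= invr0 mulr0 mul0r add0r.
  rewrite mulr_ge0 ?powR_ge0// mulr_ge0 ?paraboloid_tail_ge0//.
  by rewrite exprn_ge0// enorm_ge0.
have r0 : 0 < enorm w by rewrite lt0r enorm_eq0 w0 enorm_ge0.
rewrite /K; set r := enorm w; set s := enorm y.
have s0 : 0 <= s by exact: enorm_ge0.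
have rs0 : 0 <= r * s by rewrite mulr_ge0// ltW.
have -> : d%:R / 2 - 3 / 2 = (d%:R - 3) / 2 :> R by field.
set e := (d%:R - 3) / 2.
have e0 : 0 <= e by rewrite divr_ge0//; lra.
have x1 : expR (- (r * s - dotp w y) / 2) <= 1.
  by rewrite -expR0 ler_expR mulNr oppr_le0 divr_ge0// subr_ge0 dotp_le.
(* The two cases give [1 + r * s <= 2] and [1 + r * s <= 2 * (r * s)]. In the second one |s w| > 1,
   so [paraboloid_tail] is the full profile there. *)
have [rs1|rs1] := leP (r * s) 1.
  apply: (@le_trans _ _ ((r ^+ (d - 2))^-1 * 2 `^ e)).
    apply: ler_pM; rewrite ?powR_ge0 ?divr_ge0 ?expR_ge0 ?exprn_ge0 ?(ltW r0)//.
      by rewrite ler_piMl// invr_ge0 exprn_ge0// ltW.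
    by apply: ge0_ler_powR; rewrite ?nnegrE ?addr_ge0// -[leRHS]/(1 + 1) lerD2l.
  rewrite mulrC ler_wpM2l ?powR_ge0// lerDl mulr_ge0 ?paraboloid_tail_ge0//.
  exact: exprn_ge0.
have sn0 : s != 0.
  by apply: contraTneq rs1 => ->; rewrite mulr0 ltr10.
apply: (@le_trans _ _ (2 `^ e *
    (s ^+ (d - 2) * paraboloid_tail (s^-1 *: y) (s *: w)))); last first.
  by rewrite ler_wpM2l ?powR_ge0// lerDr invr_ge0 exprn_ge0// ltW.
have -> : paraboloid_tail (s^-1 *: y) (s *: w) =
    expR (- (r * s - dotp w y) / 2) * (r * s) `^ (- ((d%:R - 1) / 2)).
  rewrite /paraboloid_tail ifT; last by rewrite enormZ// -/r mulrC.
  rewrite /paraboloid_profile (enormZ w s0) -/r [s * r]mulrC dotpZl dotpZr mulrA.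
  by rewrite divff// mul1r.
(* Trading [s] for [r * s] lets the powers combine, as d - 2 - (d-1)/2 = e. *)
have -> : s ^+ (d - 2) = (r * s) `^ (d%:R - 2) / r ^+ (d - 2).
  have -> : d%:R - 2 = (d - 2)%:R :> R by rewrite natrB// (leq_trans _ d4).
  by rewrite powR_mulrn// exprMn mulrAC divff ?mul1r// expf_neq0// gt_eqF.
have -> : 2 `^ e * ((r * s) `^ (d%:R - 2) / r ^+ (d - 2) *
    (expR (- (r * s - dotp w y) / 2) * (r * s) `^ (- ((d%:R - 1) / 2)))) =
  expR (- (r * s - dotp w y) / 2) / r ^+ (d - 2) *
    (2 `^ e * ((r * s) `^ (d%:R - 2) * (r * s) `^ (- ((d%:R - 1) / 2)))) by ring.
rewrite -powRD; last by rewrite (@gt_eqF _ _ (r * s)) ?implybT// (lt_trans _ rs1).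
have -> : d%:R - 2 + - ((d%:R - 1) / 2) = e :> R by rewrite /e; field.
rewrite -powRM// ler_wpM2l ?divr_ge0 ?expR_ge0 ?exprn_ge0 ?(ltW r0)//.
apply: ge0_ler_powR; rewrite ?nnegrE ?addr_ge0//.
  by rewrite mulr_ge0.
by rewrite mulr_natl mulr2n lerD2r ltW.
Qed.

(** Conjugate to d/2, since 2/d + (d-2)/d = 1. *)
Local Notation conj_exp d := (d%:R / (d%:R - 2)).

(** The map from [rotation_e1] turns the direction [y] into [e1] and keeps norms, hence the cutoff.
    With [q != 0] the power still vanishes where the cutoff gives 0. *)
Lemma integral_paraboloid_tail n (q : R) (y : 'rV[R]_n.+1) : q != 0 ->
  enorm y = 1 ->
  (\int[lebesgue_rV R n.+1]_w (paraboloid_tail y w `^ q)%:E =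
   \int[lebesgue_rV R n.+1]_(w in [set w | (1 < enorm w)%R])
     (paraboloid_profile e1 w `^ q)%:E)%E.
Proof.
move=> q0 y1.
have yy : dotp y y = 1 by rewrite -sqr_enorm y1 expr1n.
have [T [[mT iT] Tn Te1]] := rotation_e1 yy.
rewrite -iT; last 2 first.
- apply/measurable_EFinP.
  exact: (measurableT_comp (measurable_powR _) (measurable_paraboloid_tail _)).
- by move=> w; rewrite lee_fin powR_ge0.
rewrite [RHS]integral_mkcond; apply: eq_integral => w _.
rewrite /paraboloid_tail patchE Tn.
have -> : (w \in [set w | 1 < enorm w]) = (1 < enorm w).
  by apply/idP/idP; rewrite inE.
case: ifPn => _; last by rewrite powR0.
by rewrite /paraboloid_profile Tn Te1.
Qed.

(** To the power q = d/(d-2) the prefactor becomes |y|^d, the Jacobian of z -> |y| (z - x). For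
    nonzero [y] the norm thus depends only on the direction of [y], and a rotation removes that
    too. *)
Lemma Lnorm_paraboloid_tail d (x y : 'rV[R]_d) : (4 <= d)%N ->
  ('N[lebesgue_rV R d]_(conj_exp d)%:E
     [EFin \o (fun z => (enorm y ^+ (d - 2) *
       paraboloid_tail ((enorm y)^-1 *: y) (enorm y *: (z - x)))%R)]
   <= kappa R d)%E.
Proof.
case: d x y => // n x y d4.
have d4R : (4 : R) <= n.+1%:R by rewrite (ler_nat R 4).
set q := conj_exp _.
have q0 : 0 < q by rewrite /q divr_gt0//; lra.
(* For [y = 0] the function vanishes identically, which is why the claim is an inequality. *)
have [->|y0] := eqVneq y 0.
  rewrite (_ : EFin \o _ = cst 0%E); last first.
    apply/funext => z /=.
    by rewrite enorm0 expr0n subn_eq0 leqNgt (leq_trans _ d4)//= mul0r.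
  by rewrite Lnorm0 ?poweR_ge0// eqe gt_eqF.
have s0 : 0 < enorm y by rewrite lt0r enorm_eq0 y0 enorm_ge0.
set s := enorm y in s0 *.
rewrite unlock /kappa -/q.
have -> : (n.+1%:R - 2) / n.+1%:R = q^-1 by rewrite invf_div.
have ys : enorm (s^-1 *: y) = 1.
  by rewrite enormZ ?invr_ge0 ?ltW// mulVf// gt_eqF.
have qn0 : q != 0 by rewrite gt_eqF.
rewrite -(integral_paraboloid_tail qn0 ys).
rewrite le_eqVlt; apply/orP; left.
apply/eqP.
apply: (congr1 (poweR^~ q^-1)).
pose F w := ((paraboloid_tail (s^-1 *: y) w) `^ q)%:E.
have mF : measurable_fun setT F.
  apply/measurable_EFinP.
  exact: (measurableT_comp (measurable_powR _) (measurable_paraboloid_tail _)).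
have F0 w : (0 <= F w)%E by rewrite lee_fin powR_ge0.
transitivity (\int[lebesgue_rV R n.+1]_z
    ((s ^+ n.+1)%:E * F (s *: z + - (s *: x))%R))%E.
  apply: eq_integral => z _; rewrite /F /= scalerBr.
  rewrite ger0_norm ?mulr_ge0 ?paraboloid_tail_ge0 ?exprn_ge0 ?(ltW s0)//.
  rewrite powRM ?paraboloid_tail_ge0 ?exprn_ge0 ?(ltW s0)// EFinM.
  congr (_%:E * _)%E.
  rewrite -!powR_mulrn ?(ltW s0)// -powRrM; congr powR.
  by rewrite /q natrB ?(leq_trans _ d4)//; field; rewrite gt_eqF//; lra.
exact: (ge0_integral_rV_dilate (- (s *: x)) s0 mF F0).
Qed.

End kernel_bound.

(** * Assembly of the two-sided estimate *)

Theorem proposition1p4 (R : realType) (d : nat) (d_ge4 : (4 <= d)%N)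
    (V : 'rV[R]_d -> R) (mV : measurable_fun [set: 'rV[R]_d] V) :
  [/\ kappa R d < +oo,
      (Cd R d)^-1%:E * inv_laplacian_norm V <= Knorm V
    & Knorm V <= (2 `^ ((d%:R - 3) / 2))%:E
                 * ((Cd R d)^-1%:E * inv_laplacian_norm V
                    + kappa R d * half_dim_norm V)].
Proof.
have C0 := Cd_gt0 (R := R) d_ge4.
have d4R : ((4 : R) <= d%:R)%R by rewrite (ler_nat R 4).
pose A x := \int[lebesgue_rV R d]_z (`|V z| / enorm (z - x) ^+ (d - 2))%:E.
have CA x : A x = (Cd R d)^-1%:E * neg_inv_laplacian_abs V x.
  by rewrite /neg_inv_laplacian_abs muleA -EFinM mulVf ?mul1e// gt_eqF.
have mshift (x : 'rV[R]_d) : measurable_fun setT (fun z : 'rV[R]_d => z - x)%R.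
  have := measurable_rV_affine 1 (- x)%R.
  by congr measurable_fun; apply/funext => z; rewrite scale1r.
have mabs : measurable_fun setT (fun z => `|V z|%R) by exact: measurableT_comp.
split; first exact: kappa_lty.
  (* With the positive constant moved to the right, the supremum on the left can be bounded
     pointwise in [x]. *)
  rewrite muleC -lee_pdivlMr ?invr_gt0//.
  apply: ge_ereal_sup => _ [x _ <-].
  rewrite lee_pdivlMr ?invr_gt0// muleC -CA.
  (* The pair [(x, 0)] is admissible in [Knorm], and [K0r] identifies the integrals. *)
  apply: ereal_sup_ubound; exists x => //; exists 0%R => //.
  by apply: eq_integral => z _; rewrite K0r.
apply: ge_ereal_sup => _ [x _ [y _ <-]].
set c := (2 `^ _)%R.
have c0 : (0 <= c)%R by exact: powR_ge0.
(* The second term of [K_le] at [w = z - x], without the common constant. *)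
pose g z := (enorm y ^+ (d - 2) *
  paraboloid_tail ((enorm y)^-1 *: y) (enorm y *: (z - x)))%R.
have g0 z : (0 <= g z)%R.
  by rewrite mulr_ge0 ?paraboloid_tail_ge0// exprn_ge0// enorm_ge0.
have mg : measurable_fun setT g.
  apply: measurable_funM => //.
  apply: (measurableT_comp (measurable_paraboloid_tail _)).
  have := measurable_rV_affine (enorm y) (- (enorm y *: x))%R.
  by congr measurable_fun; apply/funext => z; rewrite scalerBr.
have mK : measurable_fun setT (fun z => (`|V z| * K (z - x) y)%:E).
  apply/measurable_EFinP; apply: measurable_funM => //.
  exact: (measurableT_comp (measurable_K y) (mshift x)).
have mA : measurable_fun setT (fun z => (`|V z| / enorm (z - x) ^+ (d - 2))%:E).
  apply/measurable_EFinP; apply: measurable_funM => //.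
  have := measurableT_comp (measurable_K 0%R) (mshift x).
  by congr measurable_fun; apply/funext => z /=; rewrite K0r.
have mVg : measurable_fun setT (fun z => (`|V z| * g z)%:E).
  by apply/measurable_EFinP; exact: measurable_funM.
apply: (@le_trans _ _ (\int[lebesgue_rV R d]_z
    (c%:E * ((`|V z| / enorm (z - x) ^+ (d - 2))%:E + (`|V z| * g z)%:E)))).
  apply: ge0_le_integral.
  - exact: measurableT.
  - by move=> z _; rewrite lee_fin mulr_ge0// K_ge0.
  - exact: mK.
  - by apply: measurable_funeM; exact: emeasurable_funD.
  - move=> z _; rewrite -EFinD -EFinM lee_fin -mulrDr [leRHS]mulrCA.
    by rewrite ler_wpM2l//; exact: K_le.
rewrite ge0_integralZl; last 4 first.
- exact: measurableT.
- exact: emeasurable_funD.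
- move=> z _; rewrite -EFinD lee_fin; apply: addr_ge0; last exact: mulr_ge0.
  by rewrite divr_ge0// exprn_ge0// enorm_ge0.
- by rewrite lee_fin.
apply: lee_wpmul2l; first by rewrite lee_fin.
rewrite ge0_integralD; last 5 first.
- exact: measurableT.
- by move=> z _; rewrite lee_fin divr_ge0// exprn_ge0// enorm_ge0.
- exact: mA.
- by move=> z _; rewrite lee_fin; exact: mulr_ge0.
- exact: mVg.
apply: leeD.
  rewrite -/(A x) CA lee_wpmul2l ?lee_fin ?invr_ge0 ?(ltW C0)//.
  by apply: ereal_sup_ubound; exists x.
(* Hoelder's inequality bounds the L^1 norm of [V \* g], which is the integral of |V| g because [g]
   is nonnegative. *)
apply: (@le_trans _ _ ('N[lebesgue_rV R d]_1[EFin \o (V \* g)%R])).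
  rewrite Lnorm1 le_eqVlt; apply/orP; left; apply/eqP.
  by apply: eq_integral => z _; rewrite /= normrM (ger0_norm (g0 z)).
have dn0 : (d%:R != 0 :> R)%R by rewrite gt_eqF//; lra.
have d2n0 : (d%:R - 2 != 0 :> R)%R by rewrite gt_eqF//; lra.
apply: le_trans (hoelder (lebesgue_rV R d) (p := (d%:R / 2)%R)
  (q := (d%:R / (d%:R - 2))%R) mV mg _ _ _) _.
- by rewrite divr_gt0//; lra.
- by rewrite divr_gt0//; lra.
- by field; apply/andP.
rewrite muleC lee_wpmul2r ?Lnorm_ge0//.
exact: Lnorm_paraboloid_tail.
Qed.
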